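(* Let $G = K_{n_0}\oplus\left(\bigcup_{i=1}^p a_iK_{n_i}\right)$ be a generalized core-satellite graph, where $p,a_1,\ldots,a_p,n_0,n_1,\ldots,n_p\geq 1$ are integers and $n_i\neq n_j$ for all $1\leq i<j\leq p$. Then: (a) $G$ has exactly $k=2$ main $\mathbf{Q}$-eigenvalues if and only if either $G$ has exactly two satellites and they have different orders, or $G$ has two or more satellites, all of the same order; (b) for $k\geq 3$, $G$ has exactly $k$ main $\mathbf{Q}$-eigenvalues if and only if $G$ has at least three satellites, having exactly $k-1$ different orders.
   Context: All graphs are finite and simple. $K_n$ is the complete graph on $n$ vertices, $aK_n$ is the disjoint union of $a$ copies of $K_n$, $\cup$ is disjoint union and $\oplus$ is the join (disjoint union plus all edges between the two vertex sets). In a generalized core-satellite graph $K_{n_0}\oplus\left(\bigcup_{i=1}^p a_iK_{n_i}\right)$, the clique $K_{n_0}$ is the core and each of the $\sum_{i=1}^p a_i$ copies of the cliques $K_{n_i}$ is a satellite, of order $n_i$; thus the satellites have $p$ different orders. $\mathbf{Q}(G)=\mathbf{D}(G)+\mathbf{A}(G)$ is the signless Laplacian matrix; an eigenvalue of $\mathbf{Q}(G)$ is main if its eigenspace is not orthogonal to the all-ones vector, and the number of main $\mathbf{Q}$-eigenvalues counts distinct such eigenvalues. *)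

(* Defs.v *)
From HB Require Import structures.
From mathcomp Require Import all_boot all_order all_algebra.

Set Implicit Arguments.
Unset Strict Implicit.
Unset Printing Implicit Defensive.

Import Order.TTheory GRing.Theory Num.Theory.
Local Open Scope ring_scope.

Record sgraph := SGraph {
  vertex :> finType;
  adj : rel vertex;
  adj_sym : symmetric adj;
  adj_irrefl : irreflexive adj }.

Section Complete.
Variable n : nat.

Definition complete_adj : rel 'I_n := fun x y => x != y.

Fact complete_adj_sym : symmetric complete_adj.
Proof. by move=> x y; rewrite /complete_adj eq_sym. Qed.

Fact complete_adj_irrefl : irreflexive complete_adj.
Proof. by move=> x; rewrite /complete_adj eqxx. Qed.

Definition complete_graph := SGraph complete_adj_sym complete_adj_irrefl.

End Complete.

Section DisjointUnion.
Variables (I : finType) (G : I -> sgraph).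

(* [tagged_as u v] is the component of [v] transported to the type of that of
   [u]; it is only meaningful when the two tags agree, which is tested first. *)
Definition dunion_adj : rel {i : I & G i} :=
  fun u v => (tag u == tag v) && adj (tagged u) (tagged_as u v).

Fact dunion_adj_sym : symmetric dunion_adj.
Proof.
move=> [i x] [j y]; rewrite /dunion_adj /= eq_sym.
by case: eqP => // eq_ji; case: i / eq_ji x => x; rewrite !tagged_asE adj_sym.
Qed.

Fact dunion_adj_irrefl : irreflexive dunion_adj.
Proof. by move=> [i x]; rewrite /dunion_adj /= tagged_asE adj_irrefl andbF. Qed.

Definition dunion := SGraph dunion_adj_sym dunion_adj_irrefl.

End DisjointUnion.

Definition copies (a : nat) (G : sgraph) : sgraph := dunion (fun _ : 'I_a => G).

Section Join.
Variables G H : sgraph.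

Definition join_adj : rel (G + H)%type := fun u v =>
  match u, v with
  | inl x, inl y => adj x y
  | inr x, inr y => adj x y
  | _, _ => true
  end.

Fact join_adj_sym : symmetric join_adj.
Proof. by move=> [x|x] [y|y] //=; rewrite adj_sym. Qed.

Fact join_adj_irrefl : irreflexive join_adj.
Proof. by move=> [x|x] /=; rewrite adj_irrefl. Qed.

Definition join_graph := SGraph join_adj_sym join_adj_irrefl.

End Join.

Definition core_satellite (n0 p : nat) (a n : 'I_p -> nat) : sgraph :=
  join_graph (complete_graph n0)
             (dunion (fun i : 'I_p => copies (a i) (complete_graph (n i)))).

(* The satellite [Tagged _ c] with tag [i] is the [c]-th copy of K_(n i). *)
Definition satellite (p : nat) (a : 'I_p -> nat) : finType :=
  {i : 'I_p & 'I_(a i)}.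

Definition satellite_order (p : nat) (a n : 'I_p -> nat)
  (s : satellite a) : nat := n (tag s).

Definition num_satellites (p : nat) (a : 'I_p -> nat) : nat := #|satellite a|.

Definition num_satellite_orders (p : nat) (a n : 'I_p -> nat) : nat :=
  size (undup (codom (@satellite_order p a n))).

Section SignlessLaplacian.
Variables (R : rcfType) (G : sgraph).

Definition degree (x : G) : nat := #|[set y | adj x y]|.

Definition adjacency_mx : 'M[R]_#|G| :=
  \matrix_(i, j) (adj (enum_val i) (enum_val j))%:R.

Definition degree_mx : 'M[R]_#|G| :=
  diag_mx (\row_i (degree (enum_val i))%:R).

Definition signless_laplacian : 'M[R]_#|G| := degree_mx + adjacency_mx.

(* [eigenspace] consists of row vectors, which is harmless as the matrix is
   symmetric; the product with the all-ones column lists the inner products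
   with the all-ones vector of a family spanning the eigenspace. *)
Definition main_Q_eigenvalue (mu : R) : bool :=
  eigenvalue signless_laplacian mu &&
  (eigenspace signless_laplacian mu *m (const_mx 1 : 'cV[R]_#|G|) != 0).

Definition has_exactly_main_Q_eigenvalues (k : nat) : Prop :=
  exists s : seq R,
    [/\ uniq s, s =i main_Q_eigenvalue & size s = k].

End SignlessLaplacian.

(* Main.v *)
(* An eigenvector with nonzero coordinate sum is constant on the core, and its
   sum over a satellite of order n_i is n_i S / (nu - 2 n_i), where S <> 0 is
   its sum over the core and nu = mu - n_0 + 2.  With m the number of
   non-core vertices, mu is main if and only if nu <> m and
     nu - m = n_0 (1 + sum_i a_i n_i / (nu - 2 n_i)).
   This secular equation has exactly one root in each of the p + 1 intervals
   cut out by the p poles 2 n_i.  So there are p + 1 main eigenvalues, or p if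
   nu = m is a root.  The latter means sum_i a_i n_i / (m - 2 n_i) = -1, which
   requires a satellite larger than all the others together, and then that
   there is at most one other satellite. *)
Require Import Defs.
From HB Require Import structures.
From mathcomp Require Import all_boot all_order all_algebra.
From mathcomp Require Import zify ring lra.

Set Implicit Arguments.
Unset Strict Implicit.
Unset Printing Implicit Defensive.

Import Order.TTheory GRing.Theory Num.Theory.
Local Open Scope ring_scope.

(** * Secular polynomials and the location of their roots *)

Lemma root_between (R : rcfType) (q : {poly R}) (u v : R) :
  u < v -> q.[u] * q.[v] < 0 -> exists2 x, u < x < v & root q x.
Proof.
move=> ltuv quv.
have [qu0 qv0] : q.[u] != 0 /\ q.[v] != 0.
  by split; apply/eqP => q0; move: quv; rewrite q0 ?mul0r ?mulr0 ltxx.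
(* Neither endpoint is a root. The open interval later keeps the roots found in neighbouring
   intervals apart. *)
have strict x : u <= x <= v -> root q x -> u < x < v.
  move=> /andP[ux xv] /rootP qx; rewrite !lt_neqAle ux xv !andbT.
  apply/andP; split; first by apply: contraNneq qu0 => ->; rewrite qx.
  by apply: contraNneq qv0 => <-; rewrite qx.
have [qu_lt|qu_ge] := ltrP q.[u] 0.
  have qv_gt : 0 < q.[v] by rewrite -(nmulr_rlt0 _ qu_lt).
  have [|x xI rx] := @poly_ivt R q u v (ltW ltuv); first by rewrite !ltW.
  by exists x => //; apply: strict.
have qu_gt : 0 < q.[u] by rewrite lt_def qu0.
have qv_lt : q.[v] < 0 by rewrite -(pmulr_rlt0 _ qu_gt).
have [|x xI rx] := @poly_ivt R (- q) u v (ltW ltuv).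
  by rewrite !hornerN oppr_le0 oppr_ge0 !ltW.
by rewrite rootN in rx; exists x => //; apply: strict.
Qed.

(* [x - d - \sum_i c i / (x - b i)] with denominators cleared. *)
Definition secular_poly (R : rcfType) (I : finType) (d : R) (c b : I -> R)
    : {poly R} :=
  ('X - d%:P) * \prod_i ('X - (b i)%:P)
    - \sum_i c i *: \prod_(j | j != i) ('X - (b j)%:P).

Section SecularPoly.
Variables (R : rcfType) (I : finType) (d : R) (c b : I -> R).
Hypotheses (c_gt0 : forall i, 0 < c i) (b_inj : injective b).

Local Notation F := (secular_poly d c b).

Lemma horner_prod_XsubC (P : pred I) x :
  (\prod_(i | P i) ('X - (b i)%:P)).[x] = \prod_(i | P i) (x - b i).
Proof. by rewrite horner_prod; apply: eq_bigr => i _; rewrite hornerXsubC. Qed.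

Lemma horner_secular x :
  F.[x] = (x - d) * \prod_i (x - b i)
    - \sum_i c i * \prod_(j | j != i) (x - b j).
Proof.
rewrite hornerD hornerN hornerM hornerXsubC horner_prod_XsubC horner_sum.
by congr (_ - _); apply: eq_bigr => i _; rewrite hornerZ horner_prod_XsubC.
Qed.

Lemma horner_secular_pole i :
  F.[b i] = - (c i * \prod_(j | j != i) (b i - b j)).
Proof.
rewrite horner_secular (bigD1 i) //= subrr mul0r mulr0 add0r (bigD1 i) //=.
rewrite [X in _ + X]big1 ?addr0 // => k neq_ki.
by rewrite (bigD1 i) 1?eq_sym //= subrr mul0r mulr0.
Qed.

Lemma horner_secular_regular x : (forall i, x != b i) ->
  F.[x] = \prod_i (x - b i) * (x - d - \sum_i c i / (x - b i)).
Proof.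
move=> xb; rewrite horner_secular mulrBr mulrC; congr (_ - _).
rewrite mulr_sumr; apply: eq_bigr => i _.
rewrite [in RHS](bigD1 i) //=; have := xb i; rewrite -subr_eq0 => xbi.
by field.
Qed.

Lemma secular_pole_neq0 i : F.[b i] != 0.
Proof.
rewrite horner_secular_pole oppr_eq0 mulf_neq0 ?(gt_eqF (c_gt0 i)) //.
by apply/prodf_neq0 => j; rewrite subr_eq0 eq_sym (inj_eq b_inj).
Qed.

(** Clearing denominators creates no root at a pole: at [b i] only the [i]-th summand survives, and
    it is nonzero because the weights are positive and the poles distinct. *)
Lemma root_secularP x :
  reflect ((forall i, x != b i) /\ x - d = \sum_i c i / (x - b i)) (root F x).
Proof.
apply: (iffP rootP) => [Fx0 | [xb fx]].
  have xb i : x != b i.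
    by apply/eqP => xbi; move: (secular_pole_neq0 i); rewrite -xbi Fx0 eqxx.
  split=> //; apply/eqP; rewrite -subr_eq0; move/eqP: Fx0.
  rewrite horner_secular_regular // mulf_eq0 => /orP[|//].
  by apply: contraLR => _; apply/prodf_neq0 => i _; rewrite subr_eq0.
by rewrite horner_secular_regular // fx subrr mulr0.
Qed.

Lemma size_secular : size F = #|I|.+2.
Proof.
have sz_prod (P : pred I) :
    size (\prod_(i | P i) ('X - (b i)%:P)) = #|P|.+1.
  rewrite size_prod => [|i _]; last by rewrite polyXsubC_eq0.
  rewrite (eq_bigr (fun=> 2%N)) => [|i _]; last by rewrite size_XsubC.
  by rewrite sum_nat_const muln2 -addnn -addSn addnK.
have sz : size (('X - d%:P) * \prod_i ('X - (b i)%:P)) = #|I|.+2.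
  rewrite size_monicM ?monicXsubC ?size_XsubC //; last first.
    by rewrite -size_poly_eq0 sz_prod.
  by rewrite sz_prod.
rewrite size_polyDl ?sz // size_polyN ltnS.
apply: leq_trans (size_sum _ _ _) _; apply/bigmax_leqP => i _.
by apply: leq_trans (size_scale_leq _ _) _; rewrite sz_prod ltnS max_card.
Qed.

(** At distance at least 1 from all poles the fractions add up to at most [\sum_i c i] in absolute
    value, so a large [x] dominates them together with [d]. *)
Lemma secular_sign_at_infinity :
  exists2 M : R, 0 < M & (forall i, - M < b i < M) /\
  forall x, (forall i, 1 <= `|x - b i|) -> M <= `|x| ->
  0 < x * (x - d - \sum_i c i / (x - b i)).
Proof.
have sum_ge0 (f : I -> R) : (forall i, 0 <= f i) -> 0 <= \sum_i f i.
  by move=> f0; apply: sumr_ge0.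
have c0 : 0 <= \sum_i c i by apply: sum_ge0 => i; apply: ltW.
have b0 : 0 <= \sum_i `|b i| by apply: sum_ge0.
have d0 := normr_ge0 d.
exists (`|d| + \sum_i `|b i| + \sum_i c i + 1); first by lra.
split=> [i | x xb xM].
  rewrite -ltr_norml (bigD1 i) //=.
  have : 0 <= \sum_(j | j != i) `|b j| by apply: sumr_ge0.
  by have := normr_ge0 (b i); lra.
have : `|\sum_i c i / (x - b i)| <= \sum_i c i.
  apply: le_trans (ler_norm_sum _ _ _) _; apply: ler_sum => i _.
  rewrite normrM normfV gtr0_norm // ler_pdivrMr.
    by rewrite ler_peMr // ltW.
  exact: lt_le_trans ltr01 (xb i).
have := ler_norm d; have := ler_norm (- d); rewrite normrN.
set S := \sum_i c i / (x - b i) => dl du; rewrite ler_norml => /andP[Sl Su].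
have [x0|x0] := ltrP x 0.
  rewrite nmulr_rgt0 //; move: xM; rewrite (ltr0_norm x0); lra.
have x1 : 0 < x by move: xM; rewrite (ger0_norm x0); lra.
by rewrite pmulr_rgt0 //; move: xM; rewrite (ger0_norm x0); lra.
Qed.

(** The sign of [F] changes between [- M - 1], which is at distance at least 1 from every pole, and
    the smallest pole. *)
Lemma root_below_poles : exists2 x, root F x & forall i, x < b i.
Proof.
have [M M0 [bM FM]] := secular_sign_at_infinity.
have lo i : - M - 1 < b i by have /andP[] := bM i; lra.
have FMlt : - M - 1 - d - \sum_i c i / (- M - 1 - b i) < 0.
  have Mneg : - M - 1 < 0 by lra.
  rewrite -(nmulr_rgt0 _ Mneg) FM => [//|i|].
    by have /andP[? _] := bM i; rewrite ler0_norm; lra.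
  by rewrite ltr0_norm; lra.
have FE : F.[- M - 1] = \prod_i (- M - 1 - b i)
    * (- M - 1 - d - \sum_i c i / (- M - 1 - b i)).
  by apply: horner_secular_regular => i; rewrite lt_eqF.
case: (pickP I) => [i0 _ | noI].
  have [i _ imin] := @Order.TotalTheory.arg_minP _ _ _ i0 xpredT b isT.
  have [||x /andP[_ xi] rx] := @root_between R F (- M - 1) (b i) => //.
    rewrite FE (bigD1 i) //= horner_secular_pole.
    set A := _ - d - _ in FMlt *.
    set P := \prod_(j | j != i) (- M - 1 - b j).
    set Q := \prod_(j | j != i) (b i - b j).
    (* Every other pole lies to the right of both endpoints, so the factors pair up into products of
       two negative numbers. *)
    have PQ : 0 < P * Q.
      rewrite -big_split /=; apply: prodr_gt0 => j ne_ji.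
      rewrite nmulr_rgt0 subr_lt0 // lt_neqAle imin // andbT.
      by rewrite (inj_eq b_inj) eq_sym.
    have -> : (- M - 1 - b i) * P * A * - (c i * Q)
      = - ((P * Q) * c i * ((- M - 1 - b i) * A)) by ring.
    rewrite oppr_lt0 mulr_gt0 ?(mulr_gt0 PQ) ?nmulr_lgt0 //.
    by rewrite subr_lt0.
  by exists x => // j; apply: lt_le_trans xi _; apply: imin.
(* Without poles, [F] is just ['X - d%:P]. *)
exists d => [|i]; last by have := noI i.
apply/rootP; rewrite horner_secular [X in _ - X]big1 ?subr0 ?subrr ?mul0r //.
by move=> i; have := noI i.
Qed.

(** The sign of [F] changes between [b i] and the next pole, or [M + 1] if [b i] is the largest
    pole. No pole lies strictly between, so each further pole contributes factors of equal sign at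
    the two ends. *)
Lemma root_above_pole i : exists2 x, root F x &
  b i < x /\ forall j, b i < b j -> x < b j.
Proof.
case: (pickP (fun k => b i < b k)) => [k0 ik0 | no_k]; last first.
  have [M M0 [bM FM]] := secular_sign_at_infinity.
  have up j : b j < M + 1 by have /andP[] := bM j; lra.
  have FMgt : 0 < M + 1 - d - \sum_i c i / (M + 1 - b i).
    have Mpos : 0 < M + 1 by lra.
    rewrite -(pmulr_rgt0 _ Mpos) FM => [//|j|].
      by have /andP[_ ?] := bM j; rewrite ger0_norm; lra.
    by rewrite gtr0_norm; lra.
  have FE : F.[M + 1] = \prod_i (M + 1 - b i)
      * (M + 1 - d - \sum_i c i / (M + 1 - b i)).
    by apply: horner_secular_regular => j; rewrite gt_eqF.
  have [||x /andP[ix _] rx] := @root_between R F (b i) (M + 1) => //.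
    rewrite FE (bigD1 i) //= horner_secular_pole.
    set A := _ - d - _ in FMgt *.
    set P := \prod_(j | j != i) (b i - b j).
    set Q := \prod_(j | j != i) (M + 1 - b j).
    have PQ : 0 < P * Q.
      rewrite -big_split /=; apply: prodr_gt0 => j ne_ji.
      rewrite mulr_gt0 ?subr_gt0 // lt_neqAle (inj_eq b_inj) ne_ji.
      by rewrite leNgt no_k.
    have -> : - (c i * P) * ((M + 1 - b i) * Q * A)
      = - ((P * Q) * c i * ((M + 1 - b i) * A)) by ring.
    by rewrite oppr_lt0 mulr_gt0 ?(mulr_gt0 PQ) // mulr_gt0 // subr_gt0.
  by exists x => //; split=> // j; rewrite no_k.
have [k ik kmin] :=
  @Order.TotalTheory.arg_minP _ _ _ k0 (fun k => b i < b k) b ik0.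
have ne_ik : i != k by apply: contraTneq ik => <-; rewrite ltxx.
have [||x /andP[ix xk] rx] := @root_between R F (b i) (b k) => //.
  rewrite !horner_secular_pole (bigD1 k) 1?eq_sym //=.
  rewrite [X in _ * - (_ * X)](bigD1 i) //=.
  set P := \prod_(j | _) (b i - b j); set Q := \prod_(j | _) (b k - b j).
  have PQ : 0 < P * Q.
    have -> : Q = \prod_(j | (j != i) && (j != k)) (b k - b j).
      by apply: eq_bigl => j; rewrite andbC.
    rewrite -big_split /=; apply: prodr_gt0 => j /andP[ne_ji ne_jk].
    have [ij|] := ltrP (b i) (b j).
      rewrite nmulr_rgt0 subr_lt0 // lt_neqAle kmin // andbT.
      by rewrite (inj_eq b_inj) eq_sym.
    rewrite le_eqVlt (inj_eq b_inj) (negPf ne_ji) /= => ji.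
    by rewrite mulr_gt0 // subr_gt0 // (lt_trans ji).
  have -> : - (c i * ((b i - b k) * P)) * - (c k * ((b k - b i) * Q))
    = - (P * Q * c i * c k * ((b k - b i) * (b k - b i))) by ring.
  rewrite oppr_lt0 mulr_gt0 ?(mulr_gt0 (mulr_gt0 PQ _)) //.
  by rewrite mulr_gt0 ?subr_gt0.
exists x => //; split=> // j ij; exact: lt_le_trans xk (kmin _ ij).
Qed.

(** The intervals are labelled by [option I]: [None] is the one below all poles, [Some i] the one
    just above [b i]. One root from each already exhausts the degree [#|I|.+1], so there are no
    others. *)
Lemma secular_roots :
  exists s : seq R, [/\ uniq s, s =i root F & size s = #|I|.+1].
Proof.
have [x /all_and2[rx xP]] : exists x : option I -> R, forall o, root F (x o) /\
    if o is Some i then b i < x o /\ (forall j, b i < b j -> x o < b j)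
    else forall i, x o < b i.
  apply: (@fin_all_exists _ (fun=> R) (fun o y => root F y /\
    if o is Some i then b i < y /\ (forall j, b i < b j -> y < b j)
    else forall i, y < b i)) => -[i|].
    by have [y] := root_above_pole i; exists y.
  by have [y] := root_below_poles; exists y.
have x_inj : injective x.
  have low i : x None != x (Some i).
    by rewrite lt_eqF // (lt_trans (xP None i)) //; case: (xP (Some i)).
  move=> [i|] [j|] // /eqP; rewrite ?(negPf (low _)) //; last first.
    by rewrite eq_sym (negPf (low _)).
  have [ixi iP] := xP (Some i); have [jxj jP] := xP (Some j).
  move/eqP => xij; congr Some; apply: b_inj; apply/eqP.
  (* If two poles differ, the root above the lower one stays below the higher pole, hence below the
     other root. *)
  case: ltgtP => // [/iP|/jP]; first by rewrite xij ltNge ltW.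
  by rewrite -xij ltNge ltW.
have F0 : F != 0 by rewrite -size_poly_eq0 size_secular.
have Us : uniq (codom x) by apply/injectiveP.
have sz : size (codom x) = #|I|.+1 by rewrite size_codom card_option.
have rs : all (root F) (codom x) by apply/allP => _ /codomP[o ->].
exists (codom x); split=> // y; apply/idP/idP => [|ry]; first exact: (allP rs).
apply: contraT => y_s.
have := @max_poly_roots _ F (y :: codom x) F0.
rewrite /= sz size_secular ltnn => -> //; first by apply/andP.
by rewrite y_s.
Qed.

End SecularPoly.

(** * The secular equation of a core-satellite graph *)

Lemma sum_ge1_eq_card (p : nat) (a : 'I_p -> nat) :
  (forall i, (1 <= a i)%N) -> (\sum_i a i)%N = p -> forall i, a i = 1%N.
Proof.
move=> a1 /eqP; rewrite -[X in _ == X](card_ord p) -sum1_card eq_sym => E i.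
have [_] := leqif_sum (fun j (_ : true) => leqif_eq (a1 j)).
by rewrite E => /esym/forallP/(_ i)/eqP.
Qed.

(** The variable is the shifted eigenvalue nu = mu - n_0 + 2. The summand n_0 of the right-hand side
    n_0 (1 + ...) is moved into the constant [d]. *)
Definition core_satellite_poly (R : rcfType) (n0 p : nat) (a n : 'I_p -> nat)
    : {poly R} :=
  secular_poly ((\sum_i a i * n i)%:R + n0%:R)
    (fun i => n0%:R * (a i * n i)%:R) (fun i => 2 * (n i)%:R).

Section CoreSatellitePoly.
Variables (R : rcfType) (p n0 : nat) (a n : 'I_p -> nat).
Hypotheses (p_ge1 : (1 <= p)%N) (n0_ge1 : (1 <= n0)%N).
Hypotheses (a_ge1 : forall i, (1 <= a i)%N) (n_ge1 : forall i, (1 <= n i)%N).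
Hypothesis n_inj : injective n.

Local Notation m := (\sum_i a i * n i)%N.

Lemma core_satellite_weight_gt0 i : 0 < n0%:R * (a i * n i)%:R :> R.
Proof. by rewrite mulr_gt0 ?ltr0n // muln_gt0 a_ge1 n_ge1. Qed.

Lemma pole_inj : injective (fun i => 2 * (n i)%:R : R).
Proof.
move=> i j /eqP; rewrite (inj_eq (mulfI _)) ?pnatr_eq0 // eqr_nat => /eqP.
exact: n_inj.
Qed.

Lemma core_satellite_rootP x :
  reflect ((forall i, x != 2 * (n i)%:R) /\
           x - m%:R = n0%:R * (1 + \sum_i (a i * n i)%:R / (x - 2 * (n i)%:R)))
          (root (core_satellite_poly R n0 a n) x).
Proof.
have sumE : \sum_i n0%:R * (a i * n i)%:R / (x - 2 * (n i)%:R)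
    = n0%:R * \sum_i (a i * n i)%:R / (x - 2 * (n i)%:R).
  by rewrite mulr_sumr; apply: eq_bigr => i _; rewrite mulrA.
apply: (iffP (root_secularP _ core_satellite_weight_gt0 pole_inj x)) => -[xb];
  rewrite sumE => E; split => //; [rewrite mulrDr -E|rewrite mulrDr in E];
  by lra.
Qed.

(** The root nu = m is the one that yields no main eigenvalue. It occurs exactly when there are at
    most two satellites, all of different orders. *)
Lemma spurious_rootP :
  reflect ((\sum_i a i)%N = p /\ (p <= 2)%N)
          (root (core_satellite_poly R n0 a n) m%:R).
Proof.
have n0R : n0%:R != 0 :> R by rewrite pnatr_eq0 -lt0n.
apply: (iffP (core_satellite_rootP _)) => [[mb]|[sum_a p2]].
  rewrite subrr => /esym/eqP; rewrite mulf_eq0 (negPf n0R) /= => /eqP sum0.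
  (* The sum in [sum0] equals -1, so some denominator must be negative. *)
  have [i mi] : exists i, (m < 2 * n i)%N.
    case: (pickP (fun i => (m < 2 * n i)%N)) => [i mi|no_i]; first by exists i.
    suff : 0 <= \sum_i (a i * n i)%:R / (m%:R - 2 * (n i)%:R : R) by lra.
    apply: sumr_ge0 => i _; rewrite divr_ge0 // subr_ge0 -natrM ler_nat.
    by rewrite leqNgt no_i.
  pose r := (\sum_(j | j != i) a j * n j)%N.
  have mE : m = (a i * n i + r)%N by rewrite (bigD1 i).
  (* Two copies would already give [2 * n i <= m]. *)
  have ai : a i = 1%N by have := a_ge1 i; have := n_ge1 i; nia.
  have {}mE : m = (n i + r)%N by rewrite mE ai mul1n.
  have ri : (r < n i)%N by lia.
  have le_r j : j != i -> (a j * n j <= r)%N.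
    by move=> ne_ji; rewrite /r (bigD1 j) //= leq_addr.
  have riR : r%:R < (n i)%:R :> R by rewrite ltr_nat.
  (* As [m = n i + r], [sum0] becomes [\sum_(j | j != i) w j = 0]; its terms
     are nonnegative and vanish only for [n j = r]. *)
  pose w j : R := (a j * n j)%:R *
    (((n i)%:R - r%:R)^-1 - (m%:R - 2 * (n j)%:R)^-1).
  have nj_r j : j != i -> (n j <= r)%N.
    by move=> /le_r; apply: leq_trans; rewrite leq_pmull.
  have njR j : j != i -> 0 < m%:R - 2 * (n j)%:R :> R.
    move=> /nj_r; rewrite mE natrD -(ler_nat R); lra.
  have w0 j : j != i -> 0 <= w j.
    move=> ne_ji; rewrite mulr_ge0 // subr_ge0 lef_pV2 ?posrE ?njR ?subr_gt0 //.
    by have := nj_r j ne_ji; rewrite mE natrD -(ler_nat R); lra.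
  have sum_w : \sum_(j | j != i) w j = 0.
    (* The first halves add up to r / (n_i - r). By [sum0] so do the second halves, since m - 2 n_i
       = r - n_i. *)
    under eq_bigr => j _ do rewrite /w mulrBr.
    rewrite sumrB -mulr_suml -natr_sum -/r.
    move: sum0; rewrite (bigD1 i) //= ai mul1n.
    set S : R := \sum_(j | _) (a j * n j)%:R / (m%:R - 2 * (n j)%:R) => sum0.
    have -> : S = - 1 - (n i)%:R / (m%:R - 2 * (n i)%:R) 
      by rewrite -[RHS]addr0 -sum0; ring.
    rewrite mE natrD; field.
    by apply/andP; split; apply/eqP; lra.
  have njE j : j != i -> n j = r.
    move=> ne_ji; have /eqP := psumr_eq0P w0 sum_w ne_ji.
    rewrite mulf_eq0 pnatr_eq0 muln_eq0.
    rewrite (gtn_eqF (a_ge1 j)) (gtn_eqF (n_ge1 j)) /=.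
    rewrite subr_eq0 (inj_eq invr_inj) mE natrD => /eqP E.
    by apply/eqP; rewrite -(eqr_nat R); apply/eqP; lra.
  (* For j distinct from i, a_j n_j <= r = n_j forces a_j = 1. All such j share the order r, so by
     injectivity there is at most one. *)
  split.
    rewrite -[RHS]card_ord -sum1_card; apply: eq_bigr => j _.
    have [->//|ne_ji] := eqVneq j i.
    have := le_r j ne_ji; have := njE j ne_ji.
    by have := a_ge1 j; have := n_ge1 j; nia.
  rewrite -[p]card_ord (cardD1 i) /= ltnS; apply/card_le1_eqP => j k.
  rewrite !inE !andbT => ji ki; apply: n_inj; by rewrite !njE.
have a1 := sum_ge1_eq_card a_ge1 sum_a.
have mE : m = (\sum_i n i)%N by apply: eq_bigr => i _; rewrite a1 mul1n.
rewrite mE; have -> : \sum_i (a i * n i)%:R / ((\sum_i n i)%:R - 2 * (n i)%:R)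
    = \sum_i (n i)%:R / ((\sum_i n i)%:R - 2 * (n i)%:R) :> R.
  by apply: eq_bigr => i _; rewrite a1 mul1n.
clear mE sum_a a1 a_ge1 a.
(* One satellite of order x gives x / (x - 2x) = -1; two of orders x and y give x / (y - x) + y / (x
   - y) = -1. *)
case: p n p_ge1 p2 n_ge1 n_inj => [//|[|[|//]]] f _ _ f_ge1 f_inj.
  have n0P : (f ord0)%:R != 0 :> R by rewrite pnatr_eq0 -lt0n.
  rewrite !big_ord1; split=> [i|].
    by rewrite (ord1 i); apply: contraNneq n0P => E; apply/eqP; lra.
  by field; apply: contraNneq n0P => E; apply/eqP; lra.
pose x : R := (f ord0)%:R; pose y : R := (f (lift ord0 ord0))%:R.
have xy : x != y by rewrite eqr_nat (inj_eq f_inj).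
rewrite !big_ord_recl !big_ord0 !addn0 addr0 natrD -/x -/y; split.
  move=> i; case: (unliftP ord0 i) => [j|] ->; rewrite ?ord1 -/x -/y.
    by apply: contraNneq xy => E; apply/eqP; lra.
  by apply: contraNneq xy => E; apply/eqP; lra.
field; rewrite !subr_eq0; apply/andP; split;
  by apply: contraNneq xy => E; apply/eqP; lra.
Qed.

End CoreSatellitePoly.

(** * Main eigenvalues through functions on the vertices *)

Lemma main_Q_eigenvalueP (R : rcfType) (G : sgraph) (mu : R) :
  reflect (exists2 x : G -> R,
      forall y, (degree y)%:R * x y + \sum_(z | adj y z) x z = mu * x y
    & \sum_z x z != 0)
    (main_Q_eigenvalue G mu).
Proof.
have sum_enum (f : G -> R) : \sum_z f z = \sum_(j < #|G|) f (enum_val j).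
  by rewrite (reindex (@enum_val G G)) //; apply/onW_bij/enum_val_bij.
pose Q := signless_laplacian R G.
have QE (v : 'rV_#|G|) (x : G -> R) j : (forall i, v 0 i = x (enum_val i)) ->
    (v *m Q) 0 j = (degree (enum_val j))%:R * x (enum_val j)
      + \sum_(z | adj (enum_val j) z) x z.
  move=> vx; rewrite /Q /signless_laplacian mulmxDr mxE /degree_mx mul_mx_diag.
  rewrite !mxE vx mulrC; congr (_ + _); rewrite [RHS]big_mkcond sum_enum.
  apply: eq_bigr => i _; rewrite vx !mxE adj_sym.
  by case: adj; rewrite ?mulr1 ?mulr0.
have sumE (v : 'rV_#|G|) (x : G -> R) : (forall i, v 0 i = x (enum_val i)) ->
    (v *m (const_mx 1 : 'cV_#|G|)) 0 0 = \sum_z x z.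
  move=> vx; rewrite mxE sum_enum; apply: eq_bigr => i _.
  by rewrite vx mxE mulr1.
apply: (iffP andP) => [[_ neq0]|[x xQ sum_x]].
  (* The rows of the eigenspace matrix span the eigenspace; if all had coordinate sum zero, the
     product with the all-ones column would vanish. *)
  have [i Wi] : exists i,
      row i (eigenspace Q mu) *m (const_mx 1 : 'cV[R]_#|G|) != 0.
    apply/existsP; rewrite -[[exists _, _]]negbK negb_exists.
    apply: contra neq0.
    move=> /forallP W0; apply/eqP/row_matrixP => i.
    by rewrite row_mul row0; apply/eqP; rewrite -[_ == _]negbK W0.
  set v := row i _ in Wi; pose x (y : G) := v 0 (enum_rank y).
  have /eigenspaceP vQ : (v <= eigenspace Q mu)%MS by apply: row_sub.
  have vx j : v 0 j = x (enum_val j) by rewrite /x enum_valK.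
  exists x => [y|].
    have := QE v x (enum_rank y) vx; rewrite enum_rankK => <-.
    by rewrite vQ mxE.
  rewrite -(sumE _ _ vx); apply: contra Wi => /eqP v0.
  by apply/eqP/matrixP => k l; rewrite !ord1 v0 mxE.
pose v : 'rV[R]_#|G| := \row_i x (enum_val i).
have vx i : v 0 i = x (enum_val i) by rewrite mxE.
have vQ : v *m Q = mu *: v.
  by apply/rowP => j; rewrite (QE _ _ _ vx) xQ !mxE.
have v1 : v *m (const_mx 1 : 'cV[R]_#|G|) != 0.
  by apply: contraNneq sum_x => v0; rewrite -(sumE _ _ vx) v0 mxE.
have v0 : v != 0 by apply: contraNneq v1 => ->; rewrite mul0mx.
split; first by apply/eigenvalueP; exists v.
have /eigenspaceP/submxP [D vD] := vQ.
by apply: contraNneq v1 => W0; rewrite vD -mulmxA W0 mulmx0.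
Qed.

(** * Eigenvectors of a core-satellite graph *)

Section CoreSatellite.
Variables (R : rcfType) (p n0 : nat) (a n : 'I_p -> nat).
Local Notation G := (core_satellite n0 a n).

Definition core_vertex (u : 'I_n0) : G := inl u.

Definition satellite_vertex (i : 'I_p) (c : 'I_(a i)) (w : 'I_(n i)) : G :=
  inr (existT _ i (existT _ c w)).

Lemma sum_vertices (f : G -> R) :
  \sum_z f z = \sum_u f (core_vertex u)
    + \sum_i \sum_(c < a i) \sum_w f (satellite_vertex c w).
Proof.
rewrite big_sumType /=; congr (_ + _); symmetry.
under eq_bigr do rewrite sig_big_dep.
by rewrite sig_big_dep /=; apply: eq_bigr => -[i [c w]].
Qed.

Lemma sum_adj_core (f : G -> R) u :
  \sum_(z | adj (core_vertex u) z) f z = \sum_z f z - f (core_vertex u).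
Proof.
rewrite [in RHS](bigD1 (core_vertex u)) //= addrAC subrr add0r.
by apply: eq_bigl => -[v|z] //; rewrite eq_sym.
Qed.

Lemma sum_adj_satellite (f : G -> R) i c w :
  \sum_(z | adj (@satellite_vertex i c w) z) f z =
  \sum_u f (core_vertex u) + \sum_v f (satellite_vertex c v)
    - f (satellite_vertex c w).
Proof.
rewrite big_mkcond sum_vertices -addrA; congr (_ + _) => /=.
(* Satellites of another index, and then the other copies of the same index, contain no
   neighbours. *)
rewrite (bigD1 i) //= [X in _ + X]big1 ?addr0 => [|j ne_ji]; last first.
  apply: big1 => d _; apply: big1 => v _.
  by rewrite /dunion_adj /= eq_sym (negPf ne_ji).
rewrite (bigD1 c) //= [X in _ + X]big1 ?addr0 => [|d ne_dc]; last first.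
  apply: big1 => v _.
  rewrite /dunion_adj /= eqxx /= !tagged_asE /= /dunion_adj /=.
  by rewrite eq_sym (negPf ne_dc).
rewrite -big_mkcond /= [in RHS](bigD1 w) //= addrAC subrr add0r.
apply: eq_bigl => v; rewrite /dunion_adj /= !tagged_asE eqxx /= /dunion_adj /=.
by rewrite !tagged_asE eqxx /= /complete_adj eq_sym.
Qed.

Lemma degree_sum (H : sgraph) (y : H) :
  (degree y)%:R = \sum_(z | adj y z) 1 :> R.
Proof.
rewrite /degree -sum1_card natr_sum; apply: eq_bigl => z.
by rewrite inE.
Qed.

Local Notation m := (\sum_i a i * n i)%N.

Lemma degree_core u : (degree (core_vertex u))%:R = n0%:R + m%:R - 1 :> R.
Proof.
rewrite degree_sum sum_adj_core sum_vertices; congr (_ + _ - _).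
  by rewrite sumr_const card_ord.
rewrite natr_sum; apply: eq_bigr => i _.
under eq_bigr do rewrite sumr_const card_ord.
by rewrite sumr_const card_ord -mulrnA mulnC.
Qed.

Lemma degree_satellite i c w :
  (degree (@satellite_vertex i c w))%:R = n0%:R + (n i)%:R - 1 :> R.
Proof.
by rewrite degree_sum sum_adj_satellite !sumr_const !card_ord.
Qed.

Hypotheses (n0_ge1 : (1 <= n0)%N).
Hypotheses (a_ge1 : forall i, (1 <= a i)%N) (n_ge1 : forall i, (1 <= n i)%N).
Hypothesis n_inj : injective n.

(** The shift to [nu] absorbs the degrees: the eigenvector equations become (nu - m) x = S on the
    core and (nu - n_i) x = S0x + T on a satellite, with S, S0x and T the sums of x over all
    vertices, the core and that satellite. Summing over each clique eliminates the entries. *)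
Lemma main_core_satelliteP (mu : R) :
  main_Q_eigenvalue G mu =
  root (core_satellite_poly R n0 a n) (mu - n0%:R + 2)
    && (mu - n0%:R + 2 != m%:R).
Proof.
have n0R : n0%:R != 0 :> R by rewrite pnatr_eq0 -lt0n.
have mulm i : (a i * n i)%:R = (a i)%:R * (n i)%:R :> R by rewrite natrM.
set nu := mu - n0%:R + 2; have muE : mu = nu + n0%:R - 2 by rewrite /nu; ring.
apply/main_Q_eigenvalueP/andP => [[x xQ]|[]].
  set S := \sum_z x z => S0; set S0x := \sum_u x (core_vertex u).
  have core u : (nu - m%:R) * x (core_vertex u) = S.
    have := xQ (core_vertex u); rewrite degree_core sum_adj_core -/S muE => E.
    by lra.
  have num : nu - m%:R != 0.
    by apply: contraNneq S0 => E; rewrite -(core (Ordinal n0_ge1)) E mul0r.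
  have coreE : (nu - m%:R) * S0x = n0%:R * S.
    rewrite mulr_sumr (eq_bigr (fun=> S)) => [|u _]; last exact: core.
    by rewrite sumr_const card_ord mulr_natl.
  have S0x0 : S0x != 0.
    apply: contraNneq S0 => E; move/eqP: coreE.
    by rewrite E mulr0 eq_sym mulf_eq0 (negPf n0R).
  pose T i (c : 'I_(a i)) := \sum_w x (satellite_vertex c w).
  have sat i (c : 'I_(a i)) w :
      (nu - (n i)%:R) * x (satellite_vertex c w) = S0x + T i c.
    have := xQ (satellite_vertex c w).
    rewrite degree_satellite sum_adj_satellite -/S0x -/(T i c) muE => E.
    by lra.
  have satE i (c : 'I_(a i)) : (nu - 2 * (n i)%:R) * T i c = (n i)%:R * S0x.
    have : (nu - (n i)%:R) * T i c = (n i)%:R * (S0x + T i c).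
      rewrite mulr_sumr (eq_bigr (fun=> S0x + T i c)) => [|w _].
        by rewrite sumr_const card_ord mulr_natl.
      exact: sat.
    by move=> E; lra.
  (* At a pole, any satellite of order [n i] would force the core sum to vanish. *)
  have nu2 i : nu - 2 * (n i)%:R != 0.
    apply/eqP => E; have /esym/eqP := satE i (Ordinal (a_ge1 i)).
    by rewrite E mul0r mulf_eq0 (negPf S0x0) pnatr_eq0 gtn_eqF // n_ge1.
  split; last by rewrite -subr_eq0.
  apply/(core_satellite_rootP n0_ge1 a_ge1 n_ge1 n_inj); split.
    by move=> i; rewrite -subr_eq0.
  apply: (mulIf S0x0); rewrite coreE -mulrA; congr (_ * _).
  rewrite /S sum_vertices -/S0x mulrDl mul1r mulr_suml; congr (_ + _).
  apply: eq_bigr => i _.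
  rewrite (eq_bigr (fun=> (n i)%:R * S0x / (nu - 2 * (n i)%:R))).
    by rewrite sumr_const card_ord mulm -mulr_natl; ring.
  by move=> c _; rewrite -(satE i c) -/(T i c) mulrAC mulfV ?mul1r .
move=> /(core_satellite_rootP n0_ge1 a_ge1 n_ge1 n_inj) [nu2 nuE] num.
(* This is the solution of the clique equations with core sum 1. The secular equation makes its
   total sum (nu - m) / n_0, which is nonzero as nu differs from m. *)
pose x (z : G) : R := match z with
  | inl _ => n0%:R^-1
  | inr s => (nu - 2 * (n (tag s))%:R)^-1
  end.
have sum_core : \sum_u x (core_vertex u) = 1.
  by rewrite sumr_const card_ord -[LHS]mulr_natl mulfV.
have sum_sat i (c : 'I_(a i)) :
    \sum_w x (satellite_vertex c w) = (n i)%:R / (nu - 2 * (n i)%:R).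
  rewrite (eq_bigr (fun=> (nu - 2 * (n i)%:R)^-1)) //.
  by rewrite sumr_const card_ord -[LHS]mulr_natl.
have sum_x : \sum_z x z = (nu - m%:R) / n0%:R.
  rewrite sum_vertices sum_core nuE mulrAC mulfV // mul1r; congr (_ + _).
  apply: eq_bigr => i _; under eq_bigr do rewrite sum_sat.
  by rewrite sumr_const card_ord mulm -[LHS]mulr_natl mulrA.
exists x; last by rewrite sum_x mulf_neq0 ?invr_eq0 // subr_eq0.
move=> [u|[i [c w]]].
  rewrite -/(core_vertex u) degree_core sum_adj_core sum_x muE /=.
  by field.
rewrite -/(satellite_vertex c w) degree_satellite sum_adj_satellite.
rewrite sum_core sum_sat muE /=.
by field; rewrite subr_eq0.
Qed.

End CoreSatellite.

(** * The number of main eigenvalues *)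

Lemma main_core_satellite_count (R : rcfType) (p n0 : nat) (a n : 'I_p -> nat)
    (p_ge1 : (1 <= p)%N) (n0_ge1 : (1 <= n0)%N)
    (a_ge1 : forall i, (1 <= a i)%N) (n_ge1 : forall i, (1 <= n i)%N)
    (n_inj : injective n) (k : nat) :
  has_exactly_main_Q_eigenvalues R (core_satellite n0 a n) k <->
  k = if (\sum_i a i == p)%N && (p <= 2)%N then p else p.+1.
Proof.
have [s [Us sE szs]] := secular_roots (((\sum_i a i * n i)%N)%:R + n0%:R : R)
  (core_satellite_weight_gt0 R n0_ge1 a_ge1 n_ge1) (@pole_inj R p n n_inj).
rewrite card_ord in szs.
set m : R := (\sum_i a i * n i)%:R; set h := fun x : R => x + (n0%:R - 2).
(* [h] undoes the shift. [rem] changes [s] only if [m] is a root, so exactly the spurious case loses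
   one of the p + 1 roots. *)
pose t := [seq h x | x <- rem m s].
have Ut : uniq t by rewrite map_inj_uniq ?rem_uniq //; apply: addIr.
have tE : t =i main_Q_eigenvalue (core_satellite n0 a n).
  move=> mu; rewrite [RHS]main_core_satelliteP //.
  have -> : mu = h (mu - n0%:R + 2) by rewrite /h; ring.
  rewrite mem_map; last exact: addIr.
  rewrite mem_rem_uniq // !inE sE andbC.
  by have -> : h (mu - n0%:R + 2) - n0%:R + 2 = mu - n0%:R + 2
    by rewrite /h; ring.
have szt : size t = if (\sum_i a i == p)%N && (p <= 2)%N then p else p.+1.
  rewrite size_map; have := sE m.
  have /sameP rootE := spurious_rootP R p_ge1 n0_ge1 a_ge1 n_ge1 n_inj.
  have : reflect ((\sum_i a i)%N = p /\ (p <= 2)%N)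
    ((\sum_i a i == p)%N && (p <= 2)%N).
    by apply: (iffP andP) => -[/eqP ? ?].
  move=> /rootE <-; rewrite -[m \in root _]/(root _ m) => <-.
  by case: ifP => ms; [rewrite size_rem // szs | rewrite rem_id ?szs ?ms].
split=> [[u [Uu uE <-]]|->]; last by exists t.
rewrite -szt; apply/perm_size/uniq_perm => // mu.
by rewrite uE tE.
Qed.

(** * Satellites and their orders *)

Section Satellites.
Variables (p : nat) (a n : 'I_p -> nat).
Hypotheses (a_ge1 : forall i, (1 <= a i)%N) (n_inj : injective n).

Lemma num_satellitesE : num_satellites a = (\sum_i a i)%N.
Proof.
rewrite /num_satellites card_tagged sumnE big_map big_enum /=.
by apply: eq_bigr => i _; rewrite card_ord.
Qed.

Lemma leq_num_satellites : (p <= num_satellites a)%N.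
Proof.
rewrite num_satellitesE -[p in (p <= _)%N]card_ord -sum1_card.
by apply: leq_sum => i _.
Qed.

Lemma num_satellite_ordersE : num_satellite_orders a n = p.
Proof.
have Un : uniq (codom n) by apply/injectiveP.
rewrite /num_satellite_orders -[RHS]card_ord -(size_codom n).
apply/perm_size/uniq_perm; rewrite ?undup_uniq // => k; rewrite mem_undup.
apply/codomP/codomP => [[s ->]|[i ->]]; first by exists (tag s).
by exists (existT _ i (Ordinal (a_ge1 i))).
Qed.

(** Exactly p orders occur, so the order map is injective precisely when its list of values, one per
    satellite, has no repetition to discard. *)
Lemma distinct_satellite_orders :
  (forall s t : satellite a,
     s <> t -> satellite_order n s <> satellite_order n t)
  <-> num_satellites a = p.
Proof.
rewrite -[X in _ <-> _ = X]num_satellite_ordersE /num_satellites.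
rewrite -(size_codom (@satellite_order p a n)) /num_satellite_orders.
set c := codom _.
have uniqE : size c = size (undup c) <-> injective (@satellite_order p a n).
  split=> [szE|/injectiveP Uc]; last by rewrite undup_id.
  by apply/injectiveP; rewrite /injectiveb /dinjectiveb -/(codom _) -/c;
    rewrite (uniq_size_uniq (undup_uniq c)) ?szE // => x; rewrite mem_undup.
rewrite uniqE; split=> inj s t.
  by move=> st; have [//|/eqP/inj] := eqVneq s t.
by move=> neq_st /inj.
Qed.

Lemma equal_satellite_orders :
  (forall s t : satellite a, satellite_order n s = satellite_order n t)
  <-> (p <= 1)%N.
Proof.
split=> [eq_st|p1 s t]; last first.
  rewrite /satellite_order; move: (tag s) (tag t) => i j; congr n.
  by apply: val_inj => /=; have := ltn_ord i; have := ltn_ord j; lia.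
rewrite -[p]card_ord; apply/card_le1_eqP => i j _ _; apply: n_inj.
exact: (eq_st (existT _ j (Ordinal (a_ge1 j)))
              (existT _ i (Ordinal (a_ge1 i)))).
Qed.

End Satellites.

Theorem theorem5 (R : rcfType) (p n0 : nat) (a n : 'I_p -> nat)
    (p_ge1 : (1 <= p)%N) (n0_ge1 : (1 <= n0)%N)
    (a_ge1 : forall i, (1 <= a i)%N) (n_ge1 : forall i, (1 <= n i)%N)
    (n_distinct : forall i j : 'I_p, (i < j)%N -> n i <> n j) :
  (has_exactly_main_Q_eigenvalues R (core_satellite n0 a n) 2 <->
     (num_satellites a = 2%N /\
        (forall s t : satellite a, s <> t ->
           satellite_order n s <> satellite_order n t))
     \/ ((2 <= num_satellites a)%N /\
        (forall s t : satellite a,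
           satellite_order n s = satellite_order n t)))
  /\
  (forall k : nat, (3 <= k)%N ->
     (has_exactly_main_Q_eigenvalues R (core_satellite n0 a n) k <->
        (3 <= num_satellites a)%N /\ num_satellite_orders a n = (k - 1)%N)).
Proof.
have n_inj : injective n.
  move=> i j nij; apply: val_inj; case: (ltngtP i j) => // /n_distinct.
    by rewrite nij.
  by rewrite nij.
have count := main_core_satellite_count R p_ge1 n0_ge1 a_ge1 n_ge1 n_inj.
have le_p := leq_num_satellites a_ge1.
rewrite -num_satellitesE in count.
(* With N satellites, p <= N, and the count is p if N = p <= 2 and p + 1 otherwise. It is 2 for p =
   N = 2 or for p = 1 < N, and k >= 3 for p = k - 1 and N >= 3. *)
split=> [|k k3]; rewrite count.
  rewrite (distinct_satellite_orders a_ge1 n_inj).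
  rewrite (equal_satellite_orders a_ge1 n_inj).
  by case: eqP; case: (leqP p 2) => /=; lia.
rewrite (num_satellite_ordersE a_ge1 n_inj).
by case: eqP; case: (leqP p 2) => /=; lia.
Qed.
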